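(* Consider the scalar quadratic Gaussian signaling game with source $m\sim\mathcal{N}(0,\mathbb{E}[m^2])$, channel noise $w\sim\mathcal{N}(0,\mathbb{E}[w^2])$ independent of $m$ (both variances positive), encoder cost $(m-u-b)^2+\lambda x^2$ and decoder cost $(m-u)^2$, with $b\in\mathbb{R}$, $\lambda>0$. (1) Let $g_i$ and $g_u$ denote the total costs $J^e+J^d$ at the informative affine Nash equilibrium (which exists for $\lambda<\mathbb{E}[m^2]/\mathbb{E}[w^2]$) and at the non-informative Nash equilibrium, respectively. Then $$g_i=3\sqrt{\lambda\mathbb{E}[m^2]\mathbb{E}[w^2]}+b^2\sqrt{\frac{\mathbb{E}[m^2]}{\lambda\mathbb{E}[w^2]}}-\lambda\mathbb{E}[w^2],\qquad g_u=2\mathbb{E}[m^2]+b^2 .$$ Further, the total cost in the game equilibrium is $$J^{*,g}=\begin{cases}\min\{g_i,g_u\}, & \lambda<\mathbb{E}[m^2]/\mathbb{E}[w^2],\\ g_u, & \lambda\ge\mathbb{E}[m^2]/\mathbb{E}[w^2].\end{cases}$$ (2) Let $t_i$ and $t_u$ denote the informative and the non-informative team costs, respectively. Then $$t_i=2\sqrt{2\lambda\mathbb{E}[m^2]\mathbb{E}[w^2]}+\frac{b^2}{2}-\lambda\mathbb{E}[w^2],\qquad t_u=2\mathbb{E}[m^2]+\frac{b^2}{2}.$$ Further, the socially optimal cost (the total cost in the team setup) is $$J^{*,t}=\begin{cases}\min\{t_i,t_u\}, & \lambda<2\mathbb{E}[m^2]/\mathbb{E}[w^2],\\ t_u, & 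\lambda\ge2\mathbb{E}[m^2]/\mathbb{E}[w^2].\end{cases}$$
   Context: The encoder observes $m$ and sends a real-valued $x=\gamma^e(m)$; the decoder receives $y=x+w$ and chooses $u=\gamma^d(y)\in\mathbb{R}$; policies are measurable functions. $J^e(\gamma^e,\gamma^d)=\mathbb{E}[(m-u-b)^2+\lambda x^2]$ and $J^d(\gamma^e,\gamma^d)=\mathbb{E}[(m-u)^2]$. A pair $(\gamma^{*,e},\gamma^{*,d})$ is a Nash equilibrium if $J^e(\gamma^{*,e},\gamma^{*,d})\le J^e(\gamma^e,\gamma^{*,d})$ for all $\gamma^e$ and $J^d(\gamma^{*,e},\gamma^{*,d})\le J^d(\gamma^{*,e},\gamma^d)$ for all $\gamma^d$. It is affine if $\gamma^e(m)=Am+C$, $\gamma^d(y)=Ky+L$, informative affine if moreover $A\neq0$, and non-informative if $x$ is independent of $m$ and the decoder uses only prior information. $J^{*,g}$ is the total cost $J^e+J^d$ in the game equilibrium, where the equilibria considered are the informative affine one (when it exists) and the non-informative one, the smaller total cost being taken. The socially optimal cost is $J^{*,t}=\min_{\gamma^e,\gamma^d}(J^e+J^d)$. The informative team cost $t_i$ (for $\lambda<2\mathbb{E}[m^2]/\mathbb{E}[w^2]$) is the value of $J^e+J^d$ at an affine pair $\gamma^e(m)=Am+C$, $\gamma^d(y)=Ky+L$ with $A\neq0$ in which each policy minimizes $J^e+J^d$ given the other; the non-informative team cost $t_u$ is the minimum of $J^e+J^d$ when no information is transmitted ($x$ independent of $m$). *)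

(* Defs.v *)
From HB Require Import structures.
From mathcomp Require Import all_boot all_order all_algebra.
From mathcomp Require Import all_classical all_reals all_analysis.

Set Implicit Arguments.
Unset Strict Implicit.
Unset Printing Implicit Defensive.

Import Order.TTheory GRing.Theory Num.Theory.
Import numFieldNormedType.Exports.

Local Open Scope classical_set_scope.
Local Open Scope ring_scope.

Definition independent_rv d (T : measurableType d) (R : realType)
    (P : probability T R) (X Y : T -> R) : Prop :=
  forall A B : set R, measurable A -> measurable B ->
    P (X @^-1` A `&` Y @^-1` B) = (P (X @^-1` A) * P (Y @^-1` B))%E.

(* N(0, v) with v the variance: [normal_prob] takes a standard deviation.
   The laws are compared on Borel sets only, where [normal_prob] is meaningful. *)
Definition centered_gaussian d (T : measurableType d) (R : realType)
    (P : probability T R) (X : {RV P >-> R}) (v : R) : Prop :=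
  forall A : set R, measurable A ->
    distribution P X A = normal_prob 0 (Num.sqrt v) A.

Definition is_minimum (R : realType) (S : set (\bar R)) (v : \bar R) : Prop :=
  S v /\ lbound S v.

Definition policy (R : realType) (g : R -> R) : Prop :=
  measurable_fun [set: R] g.

Definition informative_affine (R : realType) (ge gd : R -> R) : Prop :=
  exists A C K L : R,
    [/\ A != 0, forall s, ge s = A * s + C & forall y, gd y = K * y + L].

Section SignalingGame.
Context d (T : measurableType d) (R : realType) (P : probability T R).
Context (m w : {RV P >-> R}) (b lam : R).
Implicit Types ge gd : R -> R.

Definition signal ge (t : T) : R := ge (m t).
Definition action ge gd (t : T) : R := gd (signal ge t + w t).

(* The integrands are nonnegative, so the costs are well defined in [0, +oo]
   for all measurable policies. *)
Definition Je ge gd : \bar R :=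
  ('E_P[fun t =>
      ((m t - action ge gd t - b) ^+ 2 + lam * signal ge t ^+ 2)%R])%E.
Definition Jd ge gd : \bar R :=
  ('E_P[fun t => ((m t - action ge gd t) ^+ 2)%R])%E.
Definition Jtot ge gd : \bar R := (Je ge gd + Jd ge gd)%E.

Definition nash_equilibrium ge gd : Prop :=
  [/\ policy ge, policy gd,
      forall ge', policy ge' -> (Je ge gd <= Je ge' gd)%E
    & forall gd', policy gd' -> (Jd ge gd <= Jd ge gd')%E].

(* A decoder that uses only prior information does not react to its
   observation, i.e., it is a constant function. *)
Definition non_informative ge gd : Prop :=
  independent_rv P m (signal ge) /\ exists c : R, forall y, gd y = c.

Definition informative_game_costs : set (\bar R) :=
  [set c | exists ge gd,
    [/\ nash_equilibrium ge gd, informative_affine ge gd & c = Jtot ge gd]].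

Definition non_informative_game_costs : set (\bar R) :=
  [set c | exists ge gd,
    [/\ nash_equilibrium ge gd, non_informative ge gd & c = Jtot ge gd]].

Definition game_costs : set (\bar R) :=
  informative_game_costs `|` non_informative_game_costs.

Definition mutually_optimal ge gd : Prop :=
  [/\ policy ge, policy gd,
      forall ge', policy ge' -> (Jtot ge gd <= Jtot ge' gd)%E
    & forall gd', policy gd' -> (Jtot ge gd <= Jtot ge gd')%E].

Definition informative_team_costs : set (\bar R) :=
  [set c | exists ge gd,
    [/\ mutually_optimal ge gd, informative_affine ge gd & c = Jtot ge gd]].

Definition non_informative_team_costs : set (\bar R) :=
  [set c | exists ge gd,
    [/\ policy ge, policy gd, independent_rv P m (signal ge)
      & c = Jtot ge gd]].

Definition team_costs : set (\bar R) :=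
  [set c | exists ge gd, [/\ policy ge, policy gd & c = Jtot ge gd]].

End SignalingGame.

Section ClosedForms.
Context (R : realType) (b lam vm vw : R).

Definition g_i : R :=
  3 * Num.sqrt (lam * vm * vw) + b ^+ 2 * Num.sqrt (vm / (lam * vw)) - lam * vw.
Definition g_u : R := 2 * vm + b ^+ 2.
Definition t_i : R :=
  2 * Num.sqrt (2 * lam * vm * vw) + b ^+ 2 / 2 - lam * vw.
Definition t_u : R := 2 * vm + b ^+ 2 / 2.

End ClosedForms.

(* Main.v *)
Require Import Defs.
From HB Require Import structures.
From mathcomp Require Import all_boot all_order all_algebra.
From mathcomp Require Import all_classical all_reals all_analysis measurable_realfun.
From mathcomp Require Import ring lra.

Set Implicit Arguments.
Unset Strict Implicit.
Unset Printing Implicit Defensive.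

Import Order.TTheory GRing.Theory Num.Theory.
Import numFieldNormedType.Exports.

Local Open Scope classical_set_scope.
Local Open Scope ring_scope.

(* Everything rests on one converse inequality.  Write x for the signal,
   y = x + w and u for the action.  For D Q = vm vw the exponential of
     Z = m^2/2vm + w^2/2vw - y^2/2Q - (m-u)^2/2D
   has mean 1: by Tonelli and translation invariance the integral against the
   Gaussian densities of m and w turns into a product of two Gaussian
   integrals.  Since 1 + Z <= e^Z, this gives E[y^2]/Q + E[(m-u)^2]/D >= 2 for
   all measurable policies.  With D = S/2 and Q = S/lam, where
   S = sqrt (2 lam vm vw), this is the bound t_i on the team cost; with D = vm
   and Q = vw it gives t_u when lam >= 2 vm/vw; with Q = A^2 vm + vw it shows
   that the linear estimator is the best response to an affine encoder.
   The best response of the encoder to an affine decoder is obtained by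
   minimizing pointwise in m.  The values g_i and t_i then follow from the
   first-order conditions in the coefficients of affine pairs. *)

(** * Integration *)

Section Density.
Import HBNNSimple.

(** Both sides are limits of integrals of simple functions by monotone convergence, so linearity
    reduces the claim to indicators, where it is the hypothesis on [nu]. *)
Lemma ge0_integral_density d (T : measurableType d) (R : realType)
    (mu nu : {measure set T -> \bar R}) (g : T -> R) :
  measurable_fun [set: _] g -> (forall x, 0 <= g x) ->
  (forall A, measurable A -> nu A = \int[mu]_(x in A) (g x)%:E)%E ->
  forall f : T -> \bar R, measurable_fun [set: T] f -> (forall x, (0 <= f x)%E) ->
  (\int[nu]_x f x = \int[mu]_x (f x * (g x)%:E))%E.
Proof.
move=> mg g0 nuE f mf f0.
have mgE : measurable_fun [set: _] (EFin \o g) by exact/measurable_EFinP.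
pose h := nnsfun_approx measurableT mf.
have fE x : f x = limn (fun n => (h n x)%:E).
  by apply/esym/cvg_lim => //; exact: cvg_nnsfun_approx.
transitivity (limn (fun n => \int[nu]_x (h n x)%:E)%E).
  rewrite -monotone_convergence//=.
  - by apply: eq_integral => x _; exact: fE.
  - by move=> n; exact/measurable_EFinP/measurable_funTS.
  - by move=> n x _; rewrite lee_fin.
  - by move=> x _ a b ab; rewrite lee_fin; exact/lefP/nd_nnsfun_approx.
transitivity (limn (fun n => \int[mu]_x ((h n x)%:E * (g x)%:E))%E); last first.
  rewrite -monotone_convergence//=.
  - apply: eq_integral => x _; apply/cvg_lim => //; apply: cvgeZr => //.
    exact: cvg_nnsfun_approx.
  - move=> n; apply: emeasurable_funM => //.
    exact/measurable_EFinP/measurable_funTS.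
  - by move=> n x _; rewrite mule_ge0// lee_fin.
  - move=> x _ a b ab; rewrite lee_wpmul2r ?lee_fin//.
    exact/lefP/nd_nnsfun_approx.
apply: congr_lim; apply/funext => n.
under [LHS]eq_integral do rewrite fimfunE -fsumEFin//.
rewrite [LHS]ge0_integral_fsum//; last 2 first.
  - by move=> r; exact/measurable_EFinP/measurableT_comp.
  - by move=> r x _; rewrite EFinM nnfun_muleindic_ge0.
under [RHS]eq_integral.
  move=> x _; rewrite fimfunE -fsumEFin// ge0_mule_fsuml; last first.
    by move=> r; exact: nnfun_muleindic_ge0.
  over.
rewrite [RHS]ge0_integral_fsum//; last 2 first.
  - move=> r; apply: emeasurable_funM => //.
    exact/measurable_EFinP/measurableT_comp.
  - by move=> r x _; apply: mule_ge0; rewrite ?lee_fin//; exact: nnfun_muleindic_ge0.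
apply: eq_fsbigr => _ /[!inE] -[x _ <-].
under [RHS]eq_integral do rewrite EFinM -muleA.
have mA : measurable (h n @^-1` [set h n x]) by exact: measurable_sfunP.
under [LHS]eq_integral do rewrite EFinM.
rewrite !ge0_integralZl//=; last 5 first.
  - apply: emeasurable_funM => //; exact/measurable_EFinP/measurable_indic.
  - by move=> y _; rewrite mule_ge0// lee_fin.
  - by rewrite lee_fin.
  - exact/measurable_EFinP/measurable_indic.
  - by rewrite lee_fin.
congr (_ * _)%E.
rewrite integral_indic// setIT nuE// integral_mkcond/=.
apply: eq_integral => y _; rewrite patchE indicE.
by case: ifP => _; rewrite ?mul1e ?mul0e.
Qed.

End Density.

(** Independence makes the joint law agree with the product measure on rectangles, hence everywhere;
    Tonelli then splits the integral. *)
Lemma ge0_integral_indep d (T : measurableType d) (R : realType)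
    (P : probability T R) (X Y : {RV P >-> R}) (h : R * R -> \bar R) :
  independent_rv P X Y -> measurable_fun [set: _] h -> (forall z, (0 <= h z)%E) ->
  (\int[P]_t h (X t, Y t) =
   \int[distribution P X]_x \int[distribution P Y]_y h (x, y))%E.
Proof.
move=> XY mh h0.
pose XYf := fun t => (X t, Y t).
have mXY : measurable_fun [set: _] XYf.
  by apply/measurable_fun_pair; exact: measurable_funP.
rewrite -(@fubini_tonelli1 _ _ _ _ _ (distribution P X) (distribution P Y) h mh h0).
pose mXYi := isMeasurableFun.Build _ _ _ _ _ mXY.
pose XY' : {mfun T >-> (R * R)%type} := HB.pack XYf mXYi.
transitivity (\int[distribution P XY']_z h z)%E.
  by rewrite ge0_integral_distribution.
apply: eq_measure_integral => A mA _; apply/esym.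
exact: product_measure_unique.
Qed.

(** * Gaussian integrals *)

Section Gaussian.
Context {R : realType}.
Local Notation mu := (@lebesgue_measure R).
Implicit Types (v c x : R).

Lemma ge0_integral_lebesgue_shift (f : R -> \bar R) c :
  measurable_fun [set: R] f -> (forall x, (0 <= f x)%E) ->
  (\int[mu]_x f (c + x)%R = \int[mu]_x f x)%E.
Proof.
move=> mf f0.
have mc : measurable_fun [set: R] ((fun x => c + x) : R -> measurableTypeR R).
  by apply: measurable_funD => //; exact: measurable_cst.
transitivity (\int[pushforward mu ((fun x => c + x)%R : R -> measurableTypeR R)]_y f y)%E.
  by rewrite ge0_integral_pushforward.
apply: eq_measure_integral => A mA _; apply/esym.
apply: lebesgue_measure_unique => // _ [[a b]] _ <-.
transitivity (mu ((fun x => c + x) @^-1` [set` `]a, b]])); last by [].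
rewrite (_ : _ @^-1` _ = [set` `]a - c, b - c]]); last first.
  by apply/seteqP; split => x /=; rewrite !in_itv/= => /andP[? ?]; apply/andP; split; lra.
by rewrite !lebesgue_measure_itv/= !lte_fin ltrD2r; case: ifP => // _; congr EFin; ring.
Qed.

Lemma ge0_integral_lebesgueN (f : R -> \bar R) :
  measurable_fun [set: R] f -> (forall x, (0 <= f x)%E) ->
  (\int[mu]_x f (- x)%R = \int[mu]_x f x)%E.
Proof.
move=> mf f0.
transitivity (\int[pushforward mu (-%R : R -> measurableTypeR R)]_y f y)%E.
  by rewrite ge0_integral_pushforward.
by apply: eq_measure_integral => A mA _; exact: lebesgue_measureN.
Qed.

(** Keeping the exponential apart from its mass turns a change of variance into a ratio of
    masses. *)
Definition gauss v x := expR (- (x ^+ 2 / (2 * v))).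
Definition gauss_mass v := Num.sqrt (2 * pi * v).

Lemma gauss_ge0 v x : 0 <= gauss v x. Proof. exact: expR_ge0. Qed.

Lemma gauss_mass_gt0 v : 0 < v -> 0 < gauss_mass v.
Proof. by move=> v0; rewrite sqrtr_gt0 !mulr_gt0// pi_gt0. Qed.

Lemma gaussN v x : gauss v (- x) = gauss v x.
Proof. by rewrite /gauss sqrrN. Qed.

Lemma measurable_gauss v : measurable_fun [set: R] (gauss v).
Proof.
apply: measurableT_comp => //; apply: measurableT_comp => //.
by apply: measurable_funM => //; exact: measurable_funX.
Qed.

Lemma measurable_gauss_EFin v : measurable_fun [set: R] (fun x => (gauss v x)%:E).
Proof. by apply/measurable_EFinP; exact: measurable_gauss. Qed.

Lemma normal_pdf_gauss v x : 0 < v ->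
  normal_pdf 0 (Num.sqrt v) x = (gauss_mass v)^-1 * gauss v x.
Proof.
move=> v0; rewrite normal_pdfE ?gt_eqF ?sqrtr_gt0//.
rewrite /normal_peak /normal_fun /gauss /gauss_mass subr0 sqr_sqrtr ?ltW//.
have -> : v * pi *+ 2 = 2 * pi * v by rewrite -mulr_natr; ring.
by rewrite mulNr -[v *+ 2]mulr_natl.
Qed.

Lemma integral_gauss v : 0 < v ->
  (\int[mu]_x (gauss v x)%:E = (gauss_mass v)%:E)%E.
Proof.
move=> v0; have g0 := gauss_mass_gt0 v0.
have := @integral_normal_pdf R 0 (Num.sqrt v).
under eq_integral do rewrite normal_pdf_gauss// EFinM.
rewrite ge0_integralZl//=; last 3 first.
- exact: measurable_gauss_EFin.
- by move=> x _; rewrite lee_fin gauss_ge0.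
- by rewrite lee_fin invr_ge0 ltW.
move=> /(congr1 (fun z => (gauss_mass v)%:E * z)%E).
by rewrite muleA -EFinM divff ?gt_eqF// mul1e mule1.
Qed.

Lemma ge0_integral_normal_prob v (f : R -> \bar R) : 0 < v ->
  measurable_fun [set: R] f -> (forall x, (0 <= f x)%E) ->
  (\int[normal_prob 0 (Num.sqrt v)]_x f x =
   \int[mu]_x (f x * ((gauss_mass v)^-1 * gauss v x)%:E))%E.
Proof.
move=> v0 mf f0.
under [RHS]eq_integral do rewrite -normal_pdf_gauss//.
apply: ge0_integral_density => //; first exact: measurable_normal_pdf.
by move=> x; exact: normal_pdf_ge0.
Qed.

Lemma ge0_integral_normal_probN v (f : R -> \bar R) : 0 < v ->
  measurable_fun [set: R] f -> (forall x, (0 <= f x)%E) ->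
  (\int[normal_prob 0 (Num.sqrt v)]_x f (- x)%R =
   \int[normal_prob 0 (Num.sqrt v)]_x f x)%E.
Proof.
move=> v0 mf f0; have g0 := gauss_mass_gt0 v0.
rewrite !ge0_integral_normal_prob//; last exact: measurableT_comp.
under eq_integral do rewrite -gaussN.
apply: (ge0_integral_lebesgueN
  (f := fun x => f x * ((gauss_mass v)^-1 * gauss v x)%:E)%E) => [|x].
  apply: emeasurable_funM => //; apply/measurable_EFinP/measurable_funM => //.
  exact: measurable_gauss.
by rewrite mule_ge0// lee_fin mulr_ge0 ?gauss_ge0// invr_ge0 ltW.
Qed.

(** The integrand replaces the exponential of variance [v] in the density by that of variance [v'];
    only the masses remain. *)
Lemma integral_normal_prob_expR v v' : 0 < v -> 0 < v' ->
  (\int[normal_prob 0 (Num.sqrt v)]_x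
      (expR (x ^+ 2 / (2 * v) - x ^+ 2 / (2 * v')))%:E =
   (gauss_mass v' / gauss_mass v)%:E)%E.
Proof.
move=> v0 v'0; have g0 := gauss_mass_gt0 v0.
rewrite ge0_integral_normal_prob//; last first.
  apply/measurable_EFinP; apply: measurableT_comp => //; apply: measurable_funB;
    by apply: measurable_funM => //; exact: measurable_funX.
transitivity (\int[mu]_x ((gauss_mass v)^-1%:E * (gauss v' x)%:E))%E.
  apply: eq_integral => x _; rewrite -!EFinM mulrCA; congr (_ * _)%:E.
  by rewrite /gauss -expRD; congr expR; ring.
rewrite ge0_integralZl//=; last 3 first.
- exact: measurable_gauss_EFin.
- by move=> x _; rewrite lee_fin gauss_ge0.
- by rewrite lee_fin invr_ge0 ltW.
by rewrite integral_gauss// -EFinM mulrC.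
Qed.

Lemma gauss_mass_sqr v r : 0 < r -> 0 < v ->
  gauss_mass (v * r ^+ 2) / gauss_mass v = r.
Proof.
move=> r0 v0; have g0 := gauss_mass_gt0 v0.
rewrite /gauss_mass mulrA sqrtrM; last by rewrite !mulr_ge0// ?pi_ge0// ltW.
by rewrite sqrtr_sqr gtr0_norm// mulrAC divff ?mul1r// gt_eqF.
Qed.

End Gaussian.

(** * Second moments of the centered normal law *)

Section Moments.
Context {R : realType}.
Implicit Types (v c k x q : R).

(** As [r] tends to 1 the bounds become [q <= 1] and [1 <= q]; one test value of [r] near 1,
    depending on [q], replaces the limit. *)
Lemma eq1_squeeze q :
  (forall r, 1 < r -> q * (r + 1) <= 2 * r ^+ 2) ->
  (forall r, 0 < r -> r < 1 -> 2 * r ^+ 2 <= q * (r + 1)) -> q = 1.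
Proof.
move=> ub lb; apply/eqP; rewrite eq_le; apply/andP; split; rewrite leNgt; apply/negP => q1.
(* At [r = 1 + e] the upper bound would give [4 * e + 3 * q * e <= 2 * e ^+ 2], impossible for
   [0 < e < 1]. *)
- pose e := (q - 1) / (4 + q).
  have e0 : 0 < e by rewrite divr_gt0//; lra.
  have e1 : e < 1 by rewrite ltr_pdivrMr ?mul1r; lra.
  have eE : e * (4 + q) = q - 1 by rewrite divfK// gt_eqF//; lra.
  have := ub (1 + e) ltac:(lra); nra.
- have q0 : 0 < q.
    by have := lb (1 / 2) ltac:(lra) ltac:(lra); nra.
  (* At [r = 1 - e] the lower bound would give [5 * e <= 2 * e ^+ 2], impossible for
     [0 < e < 1 / 4]. *)
  pose e := (1 - q) / 4.
  have := lb (1 - e) ltac:(rewrite /e; lra) ltac:(rewrite /e; lra).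
  rewrite /e; nra.
Qed.

(* With r = sqrt (v' / v), integrating 1 + z <= e^z at z = x^2/2v - x^2/2v'
   bounds the second moment by a function of r on either side of r = 1;
   both bounds tend to v as r tends to 1. *)
Lemma integral_normal_prob_sqr v : 0 < v ->
  (\int[normal_prob 0 (Num.sqrt v)]_x (x ^+ 2)%:E = v%:E)%E.
Proof.
move=> v0; set P := normal_prob 0 (Num.sqrt v).
have v2 : v != 0 by rewrite gt_eqF.
have mq : measurable_fun [set: R] (fun x : R => (x ^+ 2)%:E).
  by apply/measurable_EFinP; exact: measurable_funX.
pose M := (\int[P]_x (x ^+ 2)%:E)%E.
have M0 : (0 <= M)%E by apply: integral_ge0 => x _; rewrite lee_fin sqr_ge0.
have P1 : (\int[P]_x 1 = 1)%E.
  by rewrite integral_cst// mul1e; exact: probability_setT.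
have expE r : 0 < r ->
    (\int[P]_x (expR (x ^+ 2 * ((1 - r ^- 2) / (2 * v))))%:E = r%:E)%E.
  move=> r0.
  have e x : x ^+ 2 * ((1 - r ^- 2) / (2 * v)) =
      x ^+ 2 / (2 * v) - x ^+ 2 / (2 * (v * r ^+ 2)).
    by field; rewrite v2 gt_eqF.
  under eq_integral do rewrite e.
  rewrite -{2}(gauss_mass_sqr r0 v0) -integral_normal_prob_expR// mulr_gt0//.
  by rewrite exprn_gt0.
have mexp r : measurable_fun [set: R]
    (fun x : R => (expR (x ^+ 2 * ((1 - r ^- 2) / (2 * v))))%:E).
  apply/measurable_EFinP; apply: measurableT_comp => //.
  by apply: measurable_funM => //; exact: measurable_funX.
have ub r : 1 < r -> (1 + ((1 - r ^- 2) / (2 * v))%:E * M <= r%:E)%E.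
  move=> r1; have r0 : 0 < r by lra.
  have k0 : 0 <= (1 - r ^- 2) / (2 * v).
    apply: divr_ge0; last by rewrite mulr_ge0// ltW.
    by rewrite subr_ge0 invf_le1 ?exprn_gt0// exprn_ege1// ltW.
  rewrite -[in leRHS]expE// -ge0_integralZl//=; last first.
    by move=> x _; rewrite lee_fin sqr_ge0.
  rewrite -{1}P1.
  rewrite -ge0_integralD//=; last 2 first.
  - by move=> x _; rewrite mule_ge0// lee_fin ?sqr_ge0.
  - exact: emeasurable_funM.
  apply: ge0_le_integral => //=.
  - by move=> x _; rewrite adde_ge0// mule_ge0// lee_fin ?sqr_ge0.
  - by apply: emeasurable_funD => //; exact: emeasurable_funM.
  - exact: mexp.
  - by move=> x _; rewrite -EFinM -EFinD lee_fin mulrC; exact: expR_ge1Dx.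
(* For [r < 1] the coefficient of the exponent is negative, so its term is moved to the right to
   keep all integrands nonnegative. *)
have lb r : 0 < r -> r < 1 -> (1 <= ((r ^- 2 - 1) / (2 * v))%:E * M + r%:E)%E.
  move=> r0 r1.
  have k0 : 0 <= (r ^- 2 - 1) / (2 * v).
    apply: divr_ge0; last by rewrite mulr_ge0// ltW.
    by rewrite subr_ge0 invf_ge1 ?exprn_gt0// exprn_ile1// ltW.
  rewrite -[in leRHS](expE r)// -ge0_integralZl//=; last first.
    by move=> x _; rewrite lee_fin sqr_ge0.
  rewrite -{1}P1.
  rewrite -ge0_integralD//=; last 3 first.
  - by move=> x _; rewrite mule_ge0// lee_fin ?sqr_ge0.
  - exact: emeasurable_funM.
  - exact: mexp.
  apply: ge0_le_integral => //=.
  - by apply: emeasurable_funD => //; [exact: emeasurable_funM|exact: mexp].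
  - move=> x _; rewrite -EFinM -EFinD lee_fin.
    have := expR_ge1Dx (x ^+ 2 * ((1 - r ^- 2) / (2 * v))); lra.
(* The upper bound at [r = 2] already excludes an infinite second moment. *)
have Mfin : M \is a fin_num.
  rewrite ge0_fin_numE// ltey; apply/eqP => My; have := ub 2 ltac:(lra).
  rewrite My gt0_muley ?addey// lte_fin divr_gt0 ?mulr_gt0//; lra.
rewrite -/M -(fineK Mfin) in ub lb *; set N := fine M in ub lb *.
congr EFin; suff : N / v = 1 by move=> h; rewrite -[N](divfK v2) h mul1r.
apply: eq1_squeeze => r r1.
- have r0 : 0 < r by lra.
  have := ub r r1; rewrite -EFinM -EFinD lee_fin => h.
  suff : (r - 1) * (N / v * (r + 1)) <= (r - 1) * (2 * r ^+ 2) by rewrite ler_pM2l ?subr_gt0.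
  suff -> : (r - 1) * (N / v * (r + 1)) = (1 + (1 - r ^- 2) / (2 * v) * N - 1) * (2 * r ^+ 2).
    by rewrite ler_wpM2r ?lerD2r// mulr_ge0// exprn_ge0// ltW.
  by field; rewrite v2 gt_eqF.
- move=> r2; have := lb r r1 r2; rewrite -EFinM -EFinD lee_fin => h.
  suff : (1 - r) * (2 * r ^+ 2) <= (1 - r) * (N / v * (r + 1)) by rewrite ler_pM2l ?subr_gt0.
  suff -> : (1 - r) * (N / v * (r + 1)) = ((r ^- 2 - 1) / (2 * v) * N + r - r) * (2 * r ^+ 2).
    by rewrite ler_wpM2r ?lerD2r// mulr_ge0// exprn_ge0// ltW.
  by field; rewrite v2 gt_eqF.
Qed.

(** Adding the integrand to its reflection in [x] removes the cross term, so only nonnegative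
    functions are integrated. *)
Lemma integral_normal_prob_affine_sqr v c k : 0 < v ->
  (\int[normal_prob 0 (Num.sqrt v)]_x ((c + k * x) ^+ 2)%:E =
   (c ^+ 2 + k ^+ 2 * v)%:E)%E.
Proof.
move=> v0; set P := normal_prob 0 (Num.sqrt v).
have mq c' k' : measurable_fun [set: R] (fun x : R => ((c' + k' * x) ^+ 2)%:E).
  apply/measurable_EFinP; apply: measurable_funX; apply: measurable_funD => //.
have sq0 (x : R) : (0 <= (x ^+ 2)%:E)%E by rewrite lee_fin sqr_ge0.
have cstE (a : R) : (\int[P]_x a%:E = a%:E)%E.
  rewrite integral_cst// -[RHS]mule1; congr (_ * _)%E; exact: probability_setT.
set I := (LHS).
have I0 : (0 <= I)%E by exact: integral_ge0.
have IE : (I + I = (2 * (c ^+ 2 + k ^+ 2 * v))%:E)%E.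
  rewrite -{2}[I](ge0_integral_normal_probN _ (f := fun x => ((c + k * x) ^+ 2)%:E))//.
  rewrite /I -ge0_integralD//; last 2 first.
  - exact: mq.
  - by under eq_fun do rewrite mulrN -mulNr; exact: mq.
  under eq_integral => x _.
    rewrite -EFinD (_ : _ + _ = 2 * c ^+ 2 + 2 * k ^+ 2 * x ^+ 2); last by ring.
    rewrite EFinD; over.
  rewrite ge0_integralD//=; last 3 first.
  - by move=> x _; rewrite lee_fin mulr_ge0// sqr_ge0.
  - by move=> x _; rewrite lee_fin mulr_ge0 ?sqr_ge0// mulr_ge0 ?sqr_ge0.
  - by apply/measurable_EFinP/measurable_funM => //; exact: measurable_funX.
  under [X in (_ + X)%E]eq_integral do rewrite EFinM.
  rewrite ge0_integralZl//=; last 2 first.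
  - by apply/measurable_EFinP; exact: measurable_funX.
  - by rewrite lee_fin mulr_ge0 ?sqr_ge0.
  rewrite integral_normal_prob_sqr// cstE.
  by rewrite -EFinM -EFinD; congr EFin; ring.
have If : I \is a fin_num.
  by rewrite ge0_fin_numE// ltey; apply/eqP => Iy; move: IE; rewrite Iy.
by move: IE; rewrite -(fineK If) -EFinD => -[h]; congr EFin; lra.
Qed.

End Moments.

(** * Gaussian random variables and the exponential identity of the channel *)

Section GaussianVariables.
Context d (T : measurableType d) (R : realType) (P : probability T R).
Implicit Types (X Y m w : {RV P >-> R}) (v vm vw c k : R).

Lemma ge0_integral_distribution_gaussian X v (f : R -> \bar R) :
  centered_gaussian X v ->
  measurable_fun [set: R] f -> (forall x, (0 <= f x)%E) ->
  (\int[distribution P X]_x f x = \int[normal_prob 0 (Num.sqrt v)]_x f x)%E.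
Proof.
move=> gX mf f0; rewrite ge0_integral_distribution//.
pose X' : T -> measurableTypeR R := X.
have mX' : measurable_fun [set: T] X'.
  by move=> mT A mA; exact: (measurable_funPT X).
transitivity (\int[pushforward P X']_x f x)%E.
  by rewrite ge0_integral_pushforward.
by apply: eq_measure_integral => A mA _; exact: gX.
Qed.

Lemma measurable_affine_sqr c k :
  measurable_fun [set: R] (fun x : R => ((c + k * x) ^+ 2)%:E).
Proof. by apply/measurable_EFinP; apply: measurable_funX; exact: measurable_funD. Qed.

Lemma integral_gaussian_affine_sqr X v c k : 0 < v -> centered_gaussian X v ->
  (\int[P]_t ((c + k * X t) ^+ 2)%:E = (c ^+ 2 + k ^+ 2 * v)%:E)%E.
Proof.
move=> v0 gX; rewrite -integral_normal_prob_affine_sqr//.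
have mf := measurable_affine_sqr c k.
have f0 x : (0 <= ((c + k * x) ^+ 2)%:E)%E by rewrite lee_fin sqr_ge0.
by rewrite -(ge0_integral_distribution_gaussian gX)// ge0_integral_distribution.
Qed.

(** At a fixed value of [X] the inner integral is that of a squared affine function of a Gaussian.
    The pair [X], [Y] will be source and noise, but also signal and source. *)
Lemma integral_indep_gaussian_sqr X Y v (c : R -> R) k : 0 < v ->
  centered_gaussian Y v -> independent_rv P X Y -> measurable_fun [set: R] c ->
  (\int[P]_t ((c (X t) + k * Y t) ^+ 2)%:E =
   \int[P]_t (c (X t) ^+ 2)%:E + (k ^+ 2 * v)%:E)%E.
Proof.
move=> v0 gY XY mc.
have mc2 : measurable_fun [set: R] (fun x => (c x ^+ 2)%:E).
  by apply/measurable_EFinP; exact: measurable_funX.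
rewrite (ge0_integral_indep (h := fun z => ((c z.1 + k * z.2) ^+ 2)%:E) XY); last 2 first.
- apply/measurable_EFinP; apply: measurable_funX; apply: measurable_funD.
    exact: measurableT_comp.
  exact: measurable_funM.
- by move=> z; rewrite lee_fin sqr_ge0.
transitivity (\int[distribution P X]_x ((c x ^+ 2)%:E + (k ^+ 2 * v)%:E))%E.
  apply: eq_integral => x _; rewrite (ge0_integral_distribution_gaussian gY); last 2 first.
  - exact: (measurable_affine_sqr (c x) k).
  - by move=> y; rewrite lee_fin sqr_ge0.
  by rewrite /= integral_normal_prob_affine_sqr.
rewrite ge0_integralD//; last 2 first.
- by move=> x _; rewrite lee_fin sqr_ge0.
- by move=> x _; rewrite lee_fin mulr_ge0 ?sqr_ge0// ltW.
rewrite ge0_integral_distribution//; last by move=> x; rewrite lee_fin sqr_ge0.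
by rewrite integral_cst// [X in (_ + _ * X)%E]probability_setT mule1.
Qed.

(** A mass is the square root of a multiple of the variance, so a product of two depends only on the
    product of the variances. Through this the constraint on [D * Q] enters. *)
Lemma gauss_massM v v' u u' : 0 < v -> 0 < v' -> 0 < u -> 0 < u' ->
  v * v' = u * u' -> gauss_mass v * gauss_mass v' = gauss_mass u * gauss_mass u' :> R.
Proof.
move=> v0 v'0 u0 u'0 vu; have pi0 : 0 <= 2 * pi :> R by rewrite mulr_ge0// pi_ge0.
have massE (a b : R) : 0 < a ->
    gauss_mass a * gauss_mass b = Num.sqrt (2 * pi * (2 * pi) * (a * b)).
  move=> a0; rewrite /gauss_mass -sqrtrM; last by rewrite mulr_ge0// ltW.
  by congr Num.sqrt; ring.
by rewrite !massE// vu.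
Qed.

(** At fixed m, the shift from w to y = x + w removes the encoder; at fixed y the action is
    constant, and a shift of m removes the decoder. The two Gaussian masses left cancel the
    normalizations of m and w. *)
Lemma integral_expR_channel m w vm vw (ge gd : R -> R) Q D :
  0 < vm -> 0 < vw -> centered_gaussian m vm -> centered_gaussian w vw ->
  independent_rv P m w -> policy ge -> policy gd ->
  0 < Q -> 0 < D -> D * Q = vm * vw ->
  (\int[P]_t (expR (m t ^+ 2 / (2 * vm) + w t ^+ 2 / (2 * vw)
     - (signal m ge t + w t) ^+ 2 / (2 * Q)
     - (m t - action m w ge gd t) ^+ 2 / (2 * D)))%:E = 1)%E.
Proof.
move=> vm0 vw0 gm gw mw mge mgd Q0 D0 DQ.
pose h (z : R * R) := (expR (z.1 ^+ 2 / (2 * vm) + z.2 ^+ 2 / (2 * vw)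
  - (ge z.1 + z.2) ^+ 2 / (2 * Q) - (z.1 - gd (ge z.1 + z.2)) ^+ 2 / (2 * D)))%:E.
have my : measurable_fun [set: R * R] (fun z => ge z.1 + z.2).
  by apply: measurable_funD => //; exact: measurableT_comp.
have mh : measurable_fun [set: R * R] h.
  apply/measurable_EFinP; apply: measurableT_comp => //.
  apply: measurable_funB; [apply: measurable_funB; [apply: measurable_funD|]|];
    apply: measurable_funM => //; apply: measurable_funX => //.
  by apply: measurable_funB => //; exact: measurableT_comp.
rewrite (ge0_integral_indep (h := h) mw)//; last by move=> z; rewrite lee_fin expR_ge0.
have [Zm0 Zw0] := (gauss_mass_gt0 vm0, gauss_mass_gt0 vw0).
(* The integrand in the coordinates (m, y): the density of w is absorbed, while the growing
   exponential in [z.1] awaits the density of m. *)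
pose k (z : R * R) := ((gauss_mass vw)^-1 * expR (z.1 ^+ 2 / (2 * vm)) *
  gauss Q z.2 * gauss D (- gd z.2 + z.1))%:E.
have k0 z : (0 <= k z)%E.
  by rewrite lee_fin !mulr_ge0 ?expR_ge0 ?gauss_ge0// invr_ge0 ltW.
have mk : measurable_fun [set: R * measurableTypeR R] k.
  apply/measurable_EFinP; apply: measurable_funM.
    apply: measurable_funM; last first.
      by apply: measurableT_comp => //; exact: measurable_gauss.
    apply: measurable_funM => //; apply: measurableT_comp => //.
    by apply: measurable_funM => //; exact: measurable_funX.
  apply: measurableT_comp; first exact: measurable_gauss.
  apply: measurable_funD => //; apply: measurableT_comp => //.
  exact: measurableT_comp.
transitivity (\int[distribution P m]_x \int[lebesgue_measure]_y k (x, y))%E.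
  apply: eq_integral => x _; rewrite (ge0_integral_distribution_gaussian gw); last 2 first.
  - exact: measurableT_comp.
  - by move=> y; rewrite lee_fin expR_ge0.
  rewrite ge0_integral_normal_prob//; last 2 first.
  - exact: measurableT_comp.
  - by move=> y; rewrite lee_fin expR_ge0.
  rewrite -(ge0_integral_lebesgue_shift (f := fun y => k (x, y)) (ge x))//; last first.
    exact: measurableT_comp.
  apply: eq_integral => y _; rewrite -EFinM; congr EFin => /=.
  rewrite mulrCA -!mulrA; congr (_ * _).
  by rewrite /gauss -!expRD; congr expR; ring.
(* Now y is the outer variable, so [gd y] is a mere translation in the inner integral. *)
rewrite fubini_tonelli//=.
pose C := (gauss_mass vw)^-1 * (gauss_mass vm)^-1.
have C0 : 0 <= C by rewrite mulr_ge0// invr_ge0 ltW.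
transitivity (\int[lebesgue_measure]_y ((C * gauss_mass D)%:E * (gauss Q y)%:E))%E.
  apply: eq_integral => y _.
  have mky : measurable_fun [set: R] (fun x => k (x, y)) by exact: measurableT_comp.
  rewrite (ge0_integral_distribution_gaussian gm)// ge0_integral_normal_prob//.
  transitivity (\int[lebesgue_measure]_x ((C * gauss Q y)%:E * (gauss D (- gd y + x))%:E))%E.
    apply: eq_integral => x _; rewrite -!EFinM; congr EFin => /=.
    have := expRN (x ^+ 2 / (2 * vm)).
    rewrite /gauss => ->.
    have := expR_gt0 (x ^+ 2 / (2 * vm)) => e0.
    rewrite /C; field; rewrite ?gt_eqF//.
  rewrite ge0_integralZl//=; last 3 first.
  - apply/measurable_EFinP; apply: measurableT_comp; first exact: measurable_gauss.
    exact: measurable_funD.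
  - by move=> x _; rewrite lee_fin gauss_ge0.
  - by rewrite lee_fin mulr_ge0// gauss_ge0.
  rewrite (ge0_integral_lebesgue_shift (f := fun x => (gauss D x)%:E)); last 2 first.
  - exact: measurable_gauss_EFin.
  - by move=> x; rewrite lee_fin gauss_ge0.
  by rewrite integral_gauss// -!EFinM; congr EFin; ring.
rewrite ge0_integralZl//=; last 3 first.
- exact: measurable_gauss_EFin.
- by move=> x _; rewrite lee_fin gauss_ge0.
- by rewrite lee_fin mulr_ge0// ltW// gauss_mass_gt0.
rewrite integral_gauss// -EFinM; congr EFin.
rewrite -mulrA (gauss_massM D0 Q0 vm0 vw0 DQ) /C; field.
by rewrite !gt_eqF.
Qed.

End GaussianVariables.

(** * Costs and the converse inequality *)

Lemma integral_probability_cst d (T : measurableType d) (R : realType)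
    (P : probability T R) (a : R) : (\int[P]__ a%:E = a%:E)%E.
Proof.
by rewrite integral_cst// -[RHS]mule1; congr (_ * _)%E; exact: probability_setT.
Qed.

Section Costs.
Context d (T : measurableType d) (R : realType) (P : probability T R).
Context (m w : {RV P >-> R}) (vm vw : R).
Context (vm0 : 0 < vm) (vw0 : 0 < vw).
Context (gm : centered_gaussian m vm) (gw : centered_gaussian w vw).
Context (mw : independent_rv P m w).
Implicit Types (ge gd : R -> R) (A C K L b lam e Q D : R).

Definition power ge : \bar R := (\int[P]_t (signal m ge t ^+ 2)%:E)%E.
(** The bias [e] is 0 for the decoder, [b] for the encoder and [b / 2] for the team. *)
Definition mse e ge gd : \bar R := (\int[P]_t ((m t - action m w ge gd t - e) ^+ 2)%:E)%E.
Definition affine A C : R -> R := fun s => A * s + C.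

Lemma policy_affine A C : policy (affine A C).
Proof. by apply: measurable_funD => //; exact: measurable_funM. Qed.

Lemma policy_cst C : policy (fun=> C : R).
Proof. exact: measurable_cst. Qed.

Lemma measurable_signal ge : policy ge -> measurable_fun [set: T] (signal m ge).
Proof. by move=> pe; exact: measurableT_comp. Qed.

Lemma measurable_action ge gd : policy ge -> policy gd ->
  measurable_fun [set: T] (action m w ge gd).
Proof.
move=> pe pd; apply: (measurableT_comp pd); apply: measurable_funD => //.
exact: measurable_signal.
Qed.

Lemma measurable_sqr (f : T -> R) : measurable_fun [set: T] f ->
  measurable_fun [set: T] (fun t => (f t ^+ 2)%:E).
Proof. by move=> mf; apply/measurable_EFinP; exact: measurable_funX. Qed.

Lemma measurable_err e ge gd : policy ge -> policy gd ->
  measurable_fun [set: T] (fun t => ((m t - action m w ge gd t - e) ^+ 2)%:E).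
Proof.
move=> pe pd; apply: measurable_sqr; apply: measurable_funB => //.
by apply: measurable_funB => //; exact: measurable_action.
Qed.

Lemma power_ge0 ge : (0 <= power ge)%E.
Proof. by apply: integral_ge0 => t _; rewrite lee_fin sqr_ge0. Qed.

Lemma mse_ge0 e ge gd : (0 <= mse e ge gd)%E.
Proof. by apply: integral_ge0 => t _; rewrite lee_fin sqr_ge0. Qed.

Lemma JdE ge gd : Jd m w ge gd = mse 0 ge gd.
Proof.
rewrite /Jd /mse unlock; apply: eq_integral => t _.
by rewrite subr0.
Qed.

Lemma JeE b lam ge gd : 0 < lam -> policy ge -> policy gd ->
  Je m w b lam ge gd = (mse b ge gd + lam%:E * power ge)%E.
Proof.
move=> lam0 pe pd; rewrite /Je unlock /mse /power.
have mx := measurable_sqr (measurable_signal pe).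
rewrite -ge0_integralZl//=; last 2 first.
- by move=> t _; rewrite lee_fin sqr_ge0.
- by rewrite lee_fin ltW.
rewrite -ge0_integralD//=; last 4 first.
- by move=> t _; rewrite lee_fin sqr_ge0.
- exact: measurable_err.
- by move=> t _; rewrite lee_fin mulr_ge0 ?sqr_ge0// ltW.
- exact: measurable_funeM.
Qed.

(** Completing the square in m - u: the team faces a single quadratic error with bias [b / 2]. *)
Lemma mse_pair b ge gd : policy ge -> policy gd ->
  (mse b ge gd + mse 0 ge gd = 2%:E * mse (b / 2) ge gd + (b ^+ 2 / 2)%:E)%E.
Proof.
move=> pe pd; rewrite /mse.
have me e := measurable_err e pe pd.
have sq0 (f : T -> R) t : [set: T] t -> (0 <= (f t ^+ 2)%:E)%E.
  by move=> _; rewrite lee_fin sqr_ge0.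
rewrite -ge0_integralZl//=; last first.
  exact: (sq0 (fun t => m t - action m w ge gd t - b / 2)).
have -> : ((b ^+ 2 / 2)%:E = \int[P]__ (b ^+ 2 / 2)%:E)%E.
  by rewrite integral_probability_cst.
rewrite -!ge0_integralD//=.
- by apply: eq_integral => t _; rewrite -EFinM -!EFinD; congr EFin; field.
- by move=> t _; rewrite lee_fin mulr_ge0// sqr_ge0.
- exact: measurable_funeM.
- by move=> t _; rewrite lee_fin divr_ge0// sqr_ge0.
- by move=> t _; rewrite lee_fin sqr_ge0.
- by move=> t _; rewrite lee_fin sqr_ge0.
Qed.

Lemma JtotE b lam ge gd : 0 < lam -> policy ge -> policy gd ->
  Jtot m w b lam ge gd =
  (2%:E * mse (b / 2) ge gd + (b ^+ 2 / 2)%:E + lam%:E * power ge)%E.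
Proof.
move=> lam0 pe pd; rewrite /Jtot JdE JeE// -mse_pair//.
by rewrite addeAC.
Qed.

(** The decoder can undo an offset of the signal and absorb the bias, which reduces error bounds to
    zero offset and zero bias. *)
Lemma mse_shift e C ge gd :
  mse e ge gd = mse 0 (fun s => ge s - C) (fun y => gd (y + C) + e).
Proof.
apply: eq_integral => t _; congr EFin; rewrite /action /signal.
by rewrite (_ : ge (m t) - C + w t + C = ge (m t) + w t); [ring|ring].
Qed.

Lemma mse_affine e A C K L :
  mse e (affine A C) (affine K L) =
  ((1 - K * A) ^+ 2 * vm + K ^+ 2 * vw + (K * C + L + e) ^+ 2)%:E.
Proof.
transitivity (\int[P]_t ((affine (1 - K * A) (- (K * C + L + e)) (m t) + (- K) * w t) ^+ 2)%:E)%E.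
  by apply: eq_integral => t _; congr EFin; rewrite /action /signal /affine; ring.
rewrite (integral_indep_gaussian_sqr _ _ gw)//; last exact: policy_affine.
transitivity (\int[P]_t ((- (K * C + L + e) + (1 - K * A) * m t) ^+ 2)%:E + ((- K) ^+ 2 * vw)%:E)%E.
  by congr (_ + _)%E; apply: eq_integral => t _; rewrite /affine addrC.
rewrite (integral_gaussian_affine_sqr _ _ vm0)// -EFinD; congr EFin; ring.
Qed.

Lemma power_affine A C : power (affine A C) = (A ^+ 2 * vm + C ^+ 2)%:E.
Proof.
rewrite addrC -(integral_gaussian_affine_sqr _ _ vm0 gm).
by apply: eq_integral => t _; rewrite /signal /affine addrC.
Qed.

(** Averaging out the noise leaves a term free of the encoder and an integrand that can be minimized
    pointwise in m. *)
Lemma Je_affine_decoder b lam ge K L : 0 < lam -> policy ge ->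
  Je m w b lam ge (affine K L) =
  (\int[P]_t ((m t - L - b - K * ge (m t)) ^+ 2 + lam * ge (m t) ^+ 2)%:E +
   (K ^+ 2 * vw)%:E)%E.
Proof.
move=> lam0 pe; rewrite JeE//; last exact: policy_affine.
have mc : measurable_fun [set: R] (fun s => s - L - b - K * ge s).
  apply: measurable_funB; last exact: measurable_funM.
  by apply: measurable_funB => //; exact: measurable_funB.
have -> : mse b ge (affine K L) =
    (\int[P]_t ((m t - L - b - K * ge (m t)) ^+ 2)%:E + (K ^+ 2 * vw)%:E)%E.
  rewrite -sqrrN -(integral_indep_gaussian_sqr (- K) vw0 gw mw mc).
  by apply: eq_integral => t _; congr EFin; rewrite /action /signal /affine; ring.
rewrite addeAC; congr (_ + _)%E; rewrite /power -ge0_integralZl//; last 3 first.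
- by apply: measurable_sqr; exact: measurable_signal.
- by move=> t _; rewrite lee_fin sqr_ge0.
- by rewrite lee_fin ltW.
rewrite -ge0_integralD//.
- by move=> t _; rewrite lee_fin sqr_ge0.
- by apply: measurable_sqr; exact: (measurableT_comp mc).
- by move=> t _; rewrite lee_fin mulr_ge0 ?sqr_ge0// ltW.
- apply: measurable_funeM; apply: measurable_sqr; exact: measurable_signal.
Qed.

(* Gibbs' inequality against the Gaussian reference with output variance Q and
   posterior variance D. *)
Lemma channel_converse e Q D ge gd : policy ge -> policy gd ->
  0 < Q -> 0 < D -> D * Q = vm * vw ->
  (2%:E <= Q^-1%:E * (power ge + vw%:E) + D^-1%:E * mse e ge gd)%E.
Proof.
move=> pe pd Q0 D0 DQ.
pose gd' y := gd (y + 0) + e.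
have pd' : policy gd'.
  apply: measurable_funD => //; apply: (measurableT_comp pd).
  exact: measurable_funD.
have pe' : policy (fun s => ge s - 0) by exact: measurable_funB.
rewrite (mse_shift _ 0) -/gd'.
have -> : power ge = power (fun s => ge s - 0).
  by apply: eq_integral => t _; rewrite /signal subr0.
move: (fun s => ge s - 0) gd' pe' pd' => {pe pd}ge {}gd pe pd.
have mx := measurable_signal pe.
have my : measurable_fun [set: T] (fun t => signal m ge t + w t) by exact: measurable_funD.
have my2 := measurable_sqr my.
have mE := measurable_err 0 pe pd.
have sqge0 (k : R) (f : T -> R) : 0 < k -> forall t, [set: T] t -> (0 <= k^-1%:E * (f t ^+ 2)%:E)%E.
  by move=> k0 t _; rewrite lee_fin mulr_ge0 ?sqr_ge0// invr_ge0 ltW.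
have sq0 (f : T -> R) t : [set: T] t -> (0 <= (f t ^+ 2)%:E)%E.
  by move=> _; rewrite lee_fin sqr_ge0.
have inv0 (k : R) : 0 < k -> (0 <= k^-1%:E)%E by move=> k0; rewrite lee_fin invr_ge0 ltW.
have -> : (power ge + vw%:E = \int[P]_t ((signal m ge t + w t) ^+ 2)%:E)%E.
  rewrite -[X in (_ + X%:E)%E](_ : 1 ^+ 2 * vw = vw); last by rewrite expr1n mul1r.
  rewrite -(integral_indep_gaussian_sqr 1 vw0 gw mw pe).
  by apply: eq_integral => t _; rewrite mul1r.
rewrite -!ge0_integralZl//=; last 4 first.
- exact: (sq0 (fun t => m t - action m w ge gd t - 0)).
- exact: inv0.
- exact: (sq0 (fun t => signal m ge t + w t)).
- exact: inv0.
rewrite -ge0_integralD//; last 4 first.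
- exact: (sqge0 Q (fun t => signal m ge t + w t)).
- exact: measurable_funeM.
- exact: (sqge0 D (fun t => m t - action m w ge gd t - 0)).
- exact: measurable_funeM.
set H := fun t : T => (Q^-1%:E * ((signal m ge t + w t) ^+ 2)%:E +
  D^-1%:E * ((m t - action m w ge gd t - 0) ^+ 2)%:E)%E.
have mH : measurable_fun [set: T] H.
  by apply: emeasurable_funD; exact: measurable_funeM.
have H0 t : (0 <= H t)%E.
  apply: adde_ge0; first exact: (sqge0 Q (fun t => signal m ge t + w t)).
  exact: (sqge0 D (fun t => m t - action m w ge gd t - 0)).
pose Z t := m t ^+ 2 / (2 * vm) + w t ^+ 2 / (2 * vw)
     - (signal m ge t + w t) ^+ 2 / (2 * Q)
     - (m t - action m w ge gd t) ^+ 2 / (2 * D).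
have EZ : (\int[P]_t (expR (Z t))%:E = 1)%E.
  exact: (integral_expR_channel vm0 vw0 gm gw mw pe pd Q0 D0 DQ).
have mZ : measurable_fun [set: T] (fun t => (expR (Z t))%:E).
  apply/measurable_EFinP; apply: measurableT_comp => //.
  apply: measurable_funB; [apply: measurable_funB; [apply: measurable_funD|]|];
    apply: measurable_funM => //; apply: measurable_funX => //.
  by apply: measurable_funB => //; exact: measurable_action.
have E2 (X : {RV P >-> R}) v : 0 < v -> centered_gaussian X v ->
    (\int[P]_t (v^-1%:E * (X t ^+ 2)%:E) = 1)%E.
  move=> v0 gX; rewrite ge0_integralZl//; last 3 first.
  - exact: measurable_sqr.
  - exact: sq0.
  - exact: inv0.
  have -> : (\int[P]_t (X t ^+ 2)%:E = v%:E)%E.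
    have := integral_gaussian_affine_sqr 0 1 v0 gX.
    rewrite expr0n expr1n mul1r add0r => <-.
    by apply: eq_integral => t _; rewrite add0r mul1r.
  by rewrite -EFinM mulVf// gt_eqF.
have mv (X : {RV P >-> R}) v : measurable_fun [set: T] (fun t => v^-1%:E * (X t ^+ 2)%:E)%E.
  by apply: measurable_funeM; exact: measurable_sqr.
have E4 : (\int[P]_t (2%:E + (vm^-1%:E * (m t ^+ 2)%:E + vw^-1%:E * (w t ^+ 2)%:E)) = 4%:E)%E.
  rewrite ge0_integralD//; last 2 first.
  - by move=> t _; rewrite adde_ge0 ?(sqge0 vm m)// (sqge0 vw w).
  - exact: emeasurable_funD.
  rewrite ge0_integralD//; last 2 first.
  - exact: (sqge0 vm m).
  - exact: (sqge0 vw w).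
  rewrite !E2// integral_probability_cst -!EFinD.
  by congr EFin; ring.
(* Twice [1 + Z <= expR Z], with the negative terms of [Z] moved across: both sides integrate
   nonnegative functions, even when a cost is infinite. The constant 4 is 2 + 1 + 1. *)
have key : (4%:E <= \int[P]_t H t + 2%:E)%E.
  have -> : (\int[P]_t H t + 2%:E = \int[P]_t (H t + 2%:E * (expR (Z t))%:E))%E.
    rewrite [RHS]ge0_integralD//; last exact: measurable_funeM.
    rewrite [X in _ = (_ + X)%E]ge0_integralZl//.
    by rewrite EZ mule1.
  rewrite -E4; apply: ge0_le_integral => //=.
  - move=> t _; rewrite !adde_ge0 ?(sqge0 vm m)// (sqge0 vw w)//.
  - by apply: emeasurable_funD => //; exact: emeasurable_funD.
  - by apply: emeasurable_funD => //; exact: measurable_funeM.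
  - move=> t _; rewrite /H -!EFinM -!EFinD lee_fin.
    have := expR_ge1Dx (Z t).
    have -> : Z t = (vm^-1 * m t ^+ 2 + vw^-1 * w t ^+ 2 -
      (Q^-1 * (signal m ge t + w t) ^+ 2 + D^-1 * (m t - action m w ge gd t - 0) ^+ 2)) / 2.
      by rewrite /Z; field; rewrite !gt_eqF.
    lra.
rewrite -(leeD2rE _ _ (isT : 2%:E \is a fin_num)) -EFinD.
by rewrite (_ : 2 + 2 = 4 :> R)//; ring.
Qed.

(** Once the noise is fixed, the action is a function of the signal, hence independent of the
    centered source, whose variance splits off from the squared error. *)
Lemma mse_indep_ge e ge gd : policy ge -> policy gd ->
  independent_rv P m (signal m ge) -> (vm%:E <= mse e ge gd)%E.
Proof.
move=> pe pd mx.
pose x : {RV P >-> R} := HB.pack (signal m ge)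
  (isMeasurableFun.Build _ _ _ _ _ (measurable_signal pe)).
have xm : independent_rv P x m.
  by move=> A B mA mB; rewrite setIC mx// muleC.
pose h (z : R * R) := ((z.1 - gd (ge z.1 + z.2) - e) ^+ 2)%:E.
have mh : measurable_fun [set: R * R] h.
  apply/measurable_EFinP; apply: measurable_funX; apply: measurable_funB => //.
  apply: measurable_funB => //; apply: (measurableT_comp pd).
  by apply: measurable_funD => //; exact: measurableT_comp.
have h0 z : (0 <= h z)%E by rewrite lee_fin sqr_ge0.
have -> : mse e ge gd = (\int[P]_t h (m t, w t))%E by [].
rewrite (ge0_integral_indep mw)// fubini_tonelli//.
have -> : vm%:E = (\int[distribution P w]__ vm%:E)%E.
  by rewrite integral_probability_cst.
apply: ge0_le_integral => //=.
- by move=> t _; rewrite lee_fin ltW.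
- exact: (measurable_fun_fubini_tonelli_G h mh h0).
move=> t _; rewrite ge0_integral_distribution//; last exact: measurableT_comp.
have mc : measurable_fun [set: R] (fun x => - (gd (x + t) + e)).
  apply: measurableT_comp => //; apply: measurable_funD => //.
  by apply: (measurableT_comp pd); exact: measurable_funD.
have := integral_indep_gaussian_sqr 1 vm0 gm xm mc.
rewrite expr1n mul1r => E.
rewrite [leRHS](_ : _ = \int[P]_s (((- (gd (x s + t) + e)) + 1 * m s) ^+ 2)%:E)%E; last first.
  by apply: eq_integral => s _; congr EFin; rewrite /x /= /signal; ring.
rewrite E leeDr// integral_ge0// => s _; by rewrite lee_fin sqr_ge0.
Qed.

(** * Equilibria of the game *)

(** The competitor [q / p] is the vertex, and the excess at [x] is [(p * x - q) ^+ 2 / p]. This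
    gives first-order conditions without derivatives. *)
Lemma quad_argmin (p q x : R) : 0 < p ->
  (forall z, p * x ^+ 2 - 2 * q * x <= p * z ^+ 2 - 2 * q * z) -> p * x = q.
Proof.
move=> p0 /(_ (q / p)) h.
have pn : p != 0 by rewrite gt_eqF.
apply/eqP; rewrite -subr_eq0 -sqrf_eq0; apply/eqP/le_anti; rewrite sqr_ge0 andbT.
have -> : (p * x - q) ^+ 2 =
    p * ((p * x ^+ 2 - 2 * q * x) - (p * (q / p) ^+ 2 - 2 * q * (q / p))).
  by field.
by rewrite pmulr_rle0// subr_le0.
Qed.

Lemma sqrt_uniq (x y : R) : 0 <= x -> x ^+ 2 = y -> Num.sqrt y = x.
Proof. by move=> x0 <-; rewrite sqrtr_sqr ger0_norm. Qed.

Lemma affineB A C : (fun s => affine A C s - C) = affine A 0.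
Proof. by apply/funext => s; rewrite /affine addrK addr0. Qed.

Lemma affine0 C : affine 0 C = cst C.
Proof. by apply/funext => s; rewrite /affine mul0r add0r. Qed.

Definition je b lam A C K L : R :=
  (1 - K * A) ^+ 2 * vm + K ^+ 2 * vw + (K * C + L + b) ^+ 2 +
  lam * (A ^+ 2 * vm + C ^+ 2).
Definition jd A C K L : R :=
  (1 - K * A) ^+ 2 * vm + K ^+ 2 * vw + (K * C + L) ^+ 2.
Definition jtot b lam A C K L : R :=
  2 * ((1 - K * A) ^+ 2 * vm + K ^+ 2 * vw + (K * C + L + b / 2) ^+ 2) +
  b ^+ 2 / 2 + lam * (A ^+ 2 * vm + C ^+ 2).

Lemma Je_affine b lam A C K L : 0 < lam ->
  Je m w b lam (affine A C) (affine K L) = (je b lam A C K L)%:E.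
Proof.
by move=> lam0; rewrite JeE ?mse_affine ?power_affine//; exact: policy_affine.
Qed.

Lemma Jd_affine A C K L : Jd m w (affine A C) (affine K L) = (jd A C K L)%:E.
Proof. by rewrite JdE mse_affine addr0. Qed.

Lemma Jtot_affine b lam A C K L : 0 < lam ->
  Jtot m w b lam (affine A C) (affine K L) = (jtot b lam A C K L)%:E.
Proof.
by move=> lam0; rewrite JtotE ?mse_affine ?power_affine//; exact: policy_affine.
Qed.

Lemma informative_affineP ge gd : informative_affine ge gd ->
  exists A C K L, [/\ A != 0, ge = affine A C & gd = affine K L].
Proof.
by move=> [A [C [K [L [A0 hge hgd]]]]]; exists A, C, K, L; split => //; apply/funext.
Qed.

Lemma affine_informative A C K L : A != 0 ->
  informative_affine (affine A C) (affine K L).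
Proof. by move=> A0; exists A, C, K, L. Qed.

(** With the noise averaged out, the cost at each m is a quadratic in the signal with leading
    coefficient [K ^+ 2 + lam]; the two equations place its vertex at [A * m + C]. *)
Lemma encoder_best_response b lam A C K L : 0 < lam ->
  A * (K ^+ 2 + lam) = K -> C * (K ^+ 2 + lam) = - K * (L + b) ->
  forall ge, policy ge ->
  (Je m w b lam (affine A C) (affine K L) <= Je m w b lam ge (affine K L))%E.
Proof.
move=> lam0 hA hC ge pe; have pa := policy_affine A C.
rewrite !Je_affine_decoder// leeD2r//.
have mi g : policy g -> measurable_fun [set: T]
    (fun t => ((m t - L - b - K * g (m t)) ^+ 2 + lam * g (m t) ^+ 2)%:E).
  move=> pg; have mg := measurable_signal pg.
  apply/measurable_EFinP; apply: measurable_funD.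
    apply: measurable_funX; apply: measurable_funB; last exact: measurable_funM.
    by apply: measurable_funB => //; exact: measurable_funB.
  by apply: measurable_funM => //; exact: measurable_funX.
apply: ge0_le_integral => //.
- by move=> t _; rewrite lee_fin addr_ge0 ?sqr_ge0// mulr_ge0 ?sqr_ge0// ltW.
- exact: mi.
- exact: mi.
move=> t _; rewrite lee_fin -subr_ge0.
set s := m t; set x := ge s; set y := affine A C s.
have hy : (K ^+ 2 + lam) * y = K * (s - L - b).
  rewrite /y /affine mulrDr mulrA [_ * A]mulrC hA [_ * C]mulrC hC; ring.
have -> : (s - L - b - K * x) ^+ 2 + lam * x ^+ 2 -
    ((s - L - b - K * y) ^+ 2 + lam * y ^+ 2) =
    (K ^+ 2 + lam) * (x - y) ^+ 2 + 2 * (x - y) * ((K ^+ 2 + lam) * y - K * (s - L - b)).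
  by ring.
by rewrite hy subrr mulr0 addr0 mulr_ge0 ?sqr_ge0// addr_ge0 ?sqr_ge0// ltW.
Qed.

(** With [Q] the output variance, the converse bounds the error below by [D = vm * vw / Q], which
    the linear estimator attains. The offset [C] is first moved into the decoder. *)
Lemma decoder_best_response A C K L :
  K * (A ^+ 2 * vm + vw) = A * vm -> K * C + L = 0 ->
  forall gd, policy gd ->
  (Jd m w (affine A C) (affine K L) <= Jd m w (affine A C) gd)%E.
Proof.
move=> hK hL gd pd; rewrite Jd_affine JdE (mse_shift _ C) affineB.
pose gd' y := gd (y + C) + 0; rewrite -/gd'.
have pd' : policy gd'.
  apply: measurable_funD => //; apply: (measurableT_comp pd).
  exact: measurable_funD.
pose Q := A ^+ 2 * vm + vw; pose D := vm * vw / Q.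
have Q0 : 0 < Q by rewrite ltr_wpDl// mulr_ge0 ?sqr_ge0// ltW.
have Qn : Q != 0 by rewrite gt_eqF.
have D0 : 0 < D by rewrite divr_gt0// mulr_gt0.
have DQ : D * Q = vm * vw by rewrite /D divfK.
have := channel_converse 0 (policy_affine A 0) pd' Q0 D0 DQ.
rewrite power_affine expr0n addr0 -EFinD -/Q -EFinM mulVf//.
have -> : jd A C K L = D.
  rewrite /jd hL expr0n addr0; apply: (mulIf Qn); rewrite DQ.
  have -> : K = A * vm / Q by rewrite -hK mulfK.
  have Qe : Q = A ^+ 2 * vm + vw by [].
  have vwe : vw = Q - A ^+ 2 * vm by rewrite Qe; ring.
  by rewrite vwe; field.
have := mse_ge0 0 (affine A 0) gd'.
case: (mse _ _ _) => [r| |] //= _; last by rewrite leey.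
rewrite -EFinM -EFinD !lee_fin => h.
have : 1 <= D^-1 * r by lra.
by rewrite mulrC ler_pdivlMr// mul1r.
Qed.

(** Sufficiency is given by the two best responses; for necessity, each equation is the vertex
    condition for an affine deviation. *)
Lemma nash_affineP b lam A C K L : 0 < lam ->
  nash_equilibrium m w b lam (affine A C) (affine K L) <->
  [/\ A * (K ^+ 2 + lam) = K, C * (K ^+ 2 + lam) = - K * (L + b),
      K * (A ^+ 2 * vm + vw) = A * vm & K * C + L = 0].
Proof.
move=> lam0; split; last first.
  move=> [hA hC hK hL]; split; try exact: policy_affine.
  - exact: encoder_best_response.
  - exact: decoder_best_response.
have Kl : 0 < K ^+ 2 + lam by rewrite ltr_wpDl// sqr_ge0.
have Av : 0 < A ^+ 2 * vm + vw by rewrite ltr_wpDl// mulr_ge0 ?sqr_ge0// ltW.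
move=> [_ _ he hd]; split.
- have h : (K ^+ 2 + lam) * vm * A = K * vm.
    apply: quad_argmin => [|A']; first exact: mulr_gt0.
    have := he _ (policy_affine A' C); rewrite !Je_affine// lee_fin /je; lra.
  by apply: (mulIf (lt0r_neq0 vm0)); rewrite -h; ring.
- rewrite mulrC; apply: quad_argmin => // C'.
  have := he _ (policy_affine A C'); rewrite !Je_affine// lee_fin /je; lra.
- rewrite mulrC; apply: quad_argmin => // K'.
  (* The intercept moves with [K'] so that the mean action is kept and only the slope is tested. *)
  have := hd _ (policy_affine K' (L + K * C - K' * C)).
  rewrite !Jd_affine lee_fin /jd; lra.
- have := hd _ (policy_affine K (- (K * C))).
  rewrite !Jd_affine lee_fin /jd subrr expr0n addr0 gerDl => h.
  by apply/eqP; rewrite -sqrf_eq0 -(rwP eqP); apply/le_anti; rewrite h sqr_ge0.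
Qed.

(* With y = 1 - KA, the two slope conditions say lam A^2 = y (1 - y) and
   vw K^2 = vm y (1 - y), whence y^2 = lam vw / vm. *)
Lemma nash_affine_cost b lam A C K L : 0 < lam -> A != 0 ->
  A * (K ^+ 2 + lam) = K -> C * (K ^+ 2 + lam) = - K * (L + b) ->
  K * (A ^+ 2 * vm + vw) = A * vm -> K * C + L = 0 ->
  lam < vm / vw /\ je b lam A C K L + jd A C K L = g_i b lam vm vw.
Proof.
move=> lam0 A0 hA hC hK hL.
have [vmn vwn lamn] : [/\ vm != 0, vw != 0 & lam != 0] by rewrite !gt_eqF.
pose y := 1 - K * A.
have KA : K * A = 1 - y by rewrite /y; ring.
have lA : lam * A ^+ 2 = y * (1 - y).
  have -> : lam * A ^+ 2 = A * (A * (K ^+ 2 + lam)) - (K * A) ^+ 2 by ring.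
  by rewrite hA mulrC KA; ring.
have vK : vw * K ^+ 2 = vm * (y * (1 - y)).
  have -> : vw * K ^+ 2 = K * (K * (A ^+ 2 * vm + vw)) - vm * (K * A) ^+ 2 by ring.
  by rewrite hK mulrA KA; ring.
have A2 : 0 < A ^+ 2 by rewrite exprn_even_gt0.
have yy : 0 < y * (1 - y) by rewrite -lA mulr_gt0.
have y0 : 0 < y by nra.
have y1 : y < 1 by nra.
have yn : y != 0 by rewrite gt_eqF.
(* Multiply the two identities [lA] and [vK], then cancel [(1 - y) ^+ 2]. *)
have y2 : vm * y ^+ 2 = lam * vw.
  have z0 : (1 - y) ^+ 2 != 0 by rewrite sqrf_eq0 gt_eqF// subr_gt0.
  apply: (mulIf z0).
  have -> : vm * y ^+ 2 * (1 - y) ^+ 2 = vm * (y * (1 - y)) * (y * (1 - y)) by ring.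
  by rewrite -vK -lA -KA; ring.
split.
  by rewrite ltr_pdivlMr// -y2 gtr_pMr// expr_lt1// ltW.
have LE : L = - (K * C) by lra.
have lC : lam * C = - K * b.
  have -> : lam * C = C * (K ^+ 2 + lam) - K ^+ 2 * C by ring.
  by rewrite hC LE; ring.
rewrite LE.
have lC2 : lam * C ^+ 2 = b ^+ 2 * (y^-1 - 1).
  have -> : C = - K * b / lam by rewrite -lC mulrAC mulfV// mul1r.
  have -> : lam * (- K * b / lam) ^+ 2 = b ^+ 2 * (vw * K ^+ 2) / (lam * vw).
    by field; rewrite vwn lamn.
  by rewrite vK -y2; field; rewrite vmn yn.
(* By [y2] the two roots in [g_i] are [vm * y] and [y^-1]. *)
rewrite /g_i (@sqrt_uniq (vm * y)); last 2 first.
- by rewrite mulr_ge0// ltW.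
- have -> : (vm * y) ^+ 2 = vm * (vm * y ^+ 2) by ring.
  by rewrite y2; ring.
rewrite (@sqrt_uniq y^-1); last 2 first.
- by rewrite invr_ge0 ltW.
- by rewrite -y2; field; rewrite vmn yn.
have -> : je b lam A C K (- (K * C)) + jd A C K (- (K * C)) =
    2 * (vm * y ^+ 2 + vw * K ^+ 2) + b ^+ 2 + vm * (lam * A ^+ 2) + lam * C ^+ 2.
  by rewrite /je /jd /y; ring.
rewrite lA vK lC2 -y2; ring.
Qed.

(** The relations for [y = 1 - K * A] are solved backwards: first [y], then [A] from
    [lam * A ^+ 2 = y * (1 - y)], then [K]. The bound on [lam] says exactly that [y < 1], which
    makes [A] nonzero. *)
Lemma nash_affine_exists b lam : 0 < lam -> lam < vm / vw ->
  exists A C K L, A != 0 /\ nash_equilibrium m w b lam (affine A C) (affine K L).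
Proof.
move=> lam0 hl.
have [vmn vwn lamn] : [/\ vm != 0, vw != 0 & lam != 0] by rewrite !gt_eqF.
pose y := Num.sqrt (lam * vw / vm).
have q0 : 0 < lam * vw / vm by rewrite divr_gt0// mulr_gt0.
have y0 : 0 < y by rewrite sqrtr_gt0.
have y2 : y ^+ 2 = lam * vw / vm by rewrite sqr_sqrtr// ltW.
have y1 : y < 1.
  by rewrite -(@expr_lt1 _ 2)// ?ltW// y2 ltr_pdivrMr// mul1r -ltr_pdivlMr.
pose A := Num.sqrt (y * (1 - y) / lam).
have A2 : A ^+ 2 = y * (1 - y) / lam.
  by rewrite sqr_sqrtr// divr_ge0 ?mulr_ge0 ?ltW// ?subr_gt0.
have A0 : A != 0 by rewrite -sqrf_eq0 A2 gt_eqF// divr_gt0// mulr_gt0// subr_gt0.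
pose K := (1 - y) / A.
have KA : K * A = 1 - y by rewrite divfK.
have hA : A * (K ^+ 2 + lam) = K.
  apply: (mulIf A0); rewrite KA.
  have -> : A * (K ^+ 2 + lam) * A = (K * A) ^+ 2 + lam * A ^+ 2 by ring.
  by rewrite KA A2; field.
have hK : K * (A ^+ 2 * vm + vw) = A * vm.
  apply: (mulIf A0).
  have -> : K * (A ^+ 2 * vm + vw) * A = (K * A) * (A ^+ 2 * vm + vw) by ring.
  have -> : A * vm * A = A ^+ 2 * vm by ring.
  have -> : vw = y ^+ 2 * vm / lam by rewrite y2; field; rewrite vmn lamn.
  by rewrite KA A2; field.
pose C := - K * b / lam; pose L := - (K * C).
exists A, C, K, L; split => //; apply/nash_affineP => //; split => //.
- by rewrite /L /C; field.
- by rewrite /L subrr.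
Qed.

Lemma informative_game_costsE b lam : 0 < lam -> lam < vm / vw ->
  informative_game_costs m w b lam = [set (g_i b lam vm vw)%:E].
Proof.
move=> lam0 hl; apply/seteqP; split => [c [ge [gd [hn hi ->]]]|_ ->].
  have [A [C [K [L [A0 ? ?]]]]] := informative_affineP hi; subst ge gd.
  have [hA hC hK hL] := (nash_affineP _ _ _ _ _ lam0).1 hn.
  have [_ <-] := nash_affine_cost lam0 A0 hA hC hK hL.
  by rewrite /Jtot Je_affine// Jd_affine.
have [A [C [K [L [A0 hn]]]]] := nash_affine_exists b lam0 hl.
exists (affine A C), (affine K L); split => //; first exact: affine_informative.
have [hA hC hK hL] := (nash_affineP _ _ _ _ _ lam0).1 hn.
have [_ <-] := nash_affine_cost lam0 A0 hA hC hK hL.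
by rewrite /Jtot Je_affine// Jd_affine.
Qed.

(** Excludes informative equilibria at and above the threshold, where the game cost is [g_u]. *)
Lemma informative_game_costs0 b lam c : 0 < lam ->
  informative_game_costs m w b lam c -> lam < vm / vw.
Proof.
move=> lam0 [ge [gd [hn hi _]]].
have [A [C [K [L [A0 ? ?]]]]] := informative_affineP hi; subst ge gd.
have [hA hC hK hL] := (nash_affineP _ _ _ _ _ lam0).1 hn.
by have [] := nash_affine_cost lam0 A0 hA hC hK hL.
Qed.

Lemma independent_rv_cst C : independent_rv P m (signal m (cst C)).
Proof.
move=> A B mA mB; have [BC|BC] := pselect (B C).
  have -> : signal m (cst C) @^-1` B = setT by apply/seteqP; split.
  by rewrite setIT probability_setT mule1.
have -> : signal m (cst C) @^-1` B = set0 by apply/seteqP; split.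
by rewrite setI0 measure0 mule0.
Qed.

(** Against a constant decoder the signal is pure expense, so its power vanishes; the best constant
    is the prior mean 0. *)
Lemma non_informative_game_costsE b lam : 0 < lam ->
  non_informative_game_costs m w b lam = [set (g_u b vm)%:E].
Proof.
move=> lam0; apply/seteqP; split => [c [ge [gd [[pe pd he hd] [_ [K hK]] ->]]]|_ ->].
  (* Under a constant decoder the error ignores the encoder, so it may be computed at an affine pair
     of slopes 0. *)
  have msec e' g K' : mse e' g (cst K') = (vm + (K' + e') ^+ 2)%:E.
    have <- : mse e' (affine 0 0) (affine 0 K') = mse e' g (cst K').
      by apply: eq_integral => t _; rewrite !affine0.
    by rewrite mse_affine; congr EFin; ring.
  have Kg : gd = cst K by apply/funext.
  subst gd; have pc C : policy (cst C : R -> R) by exact: policy_cst.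
  have K0 : K = 0.
    have := hd _ (pc 0); rewrite !JdE !msec lee_fin !addr0 expr0n addr0 gerDl => h.
    by apply/eqP; rewrite -sqrf_eq0 -(rwP eqP); apply/le_anti; rewrite h sqr_ge0.
  have := he _ (pc 0); rewrite /Jtot JdE !JeE// !msec.
  have -> : power (cst 0) = 0%E.
    by rewrite -affine0 power_affine; congr EFin; ring.
  (* Comparison with the silent encoder rules out infinite power, then forces the power to be 0. *)
  have := power_ge0 ge; case: (power ge) => [p| |] //=; last first.
    by rewrite gt0_muley ?lte_fin// addey.
  rewrite lee_fin mule0 adde0 -EFinM -EFinD lee_fin => p0 h.
  have p1 : lam * p <= 0 by lra.
  have -> : p = 0 by apply/le_anti; rewrite p0 andbT -(pmulr_rle0 _ lam0).
  by rewrite -EFinD K0 /g_u; congr EFin; ring.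
exists (affine 0 0), (affine 0 0); split.
- apply/nash_affineP => //; split; ring.
- by split; [rewrite affine0; exact: independent_rv_cst|exists 0 => y; rewrite affine0].
- by rewrite /Jtot Je_affine// Jd_affine -EFinD /je /jd /g_u; congr EFin; ring.
Qed.

Lemma game_costs_minimum b lam : 0 < lam ->
  is_minimum (game_costs m w b lam)
    (if lam < vm / vw then Num.min (g_i b lam vm vw) (g_u b vm)
     else g_u b vm)%:E.
Proof.
move=> lam0; rewrite /game_costs non_informative_game_costsE//.
case: ifPn => hl.
  rewrite informative_game_costsE//; split.
    by rewrite /Num.min; case: ifP => _; [left|right].
  by move=> _ [->|->]; rewrite lee_fin ge_min lexx ?orbT.
split; first by right.
move=> c [/informative_game_costs0 h|->]; last exact: lexx.
by rewrite h in hl.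
Qed.

(** * The team problem *)

(** An infinite power or error makes the right side infinite, so lower bounds on the total cost
    reduce to real values. *)
Lemma le_total_cost (a c x : R) (p q : \bar R) : 0 < a ->
  (0 <= p)%E -> (0 <= q)%E ->
  (forall p' q', p = p'%:E -> q = q'%:E -> 0 <= p' -> 0 <= q' ->
     x <= 2 * q' + c + a * p') ->
  (x%:E <= 2%:E * q + c%:E + a%:E * p)%E.
Proof.
move=> a0; case: p => [p| |] //; case: q => [q| |] // p0 q0 h.
- by rewrite -!EFinM -!EFinD lee_fin h.
- by rewrite gt0_muley ?lte_fin// -EFinM !addye// leey.
- by rewrite gt0_muley ?lte_fin// -EFinM -EFinD addey// leey.
- by rewrite !gt0_muley ?lte_fin// addey// leey.
Qed.

(** Multiplied by [S], the weights [1 / Q] and [1 / D] of the converse become [lam] and 2, those of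
    power and error in the total cost. *)
Lemma t_i_le_Jtot b lam ge gd : 0 < lam -> policy ge -> policy gd ->
  ((t_i b lam vm vw)%:E <= Jtot m w b lam ge gd)%E.
Proof.
move=> lam0 pe pd; rewrite JtotE//.
pose S := Num.sqrt (2 * lam * vm * vw).
have S0 : 0 < S by rewrite sqrtr_gt0 !mulr_gt0.
have S2 : S ^+ 2 = 2 * lam * vm * vw by rewrite sqr_sqrtr// !mulr_ge0// ltW.
have DQ : (S / 2) * (S / lam) = vm * vw.
  have -> : (S / 2) * (S / lam) = S ^+ 2 / (2 * lam) by field; rewrite gt_eqF.
  by rewrite S2; field; rewrite gt_eqF.
have := channel_converse (b / 2) pe pd (divr_gt0 S0 lam0) (divr_gt0 S0 (ltr0n _ 2)) DQ.
rewrite /t_i -/S => conv.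
apply: le_total_cost => //; [exact: power_ge0|exact: mse_ge0|move=> p q pE qE p0 q0].
move: conv; rewrite pE qE -!EFinM -!EFinD lee_fin => h.
have : 2 * S <= lam * (p + vw) + 2 * q.
  have -> : lam * (p + vw) + 2 * q = ((S / lam)^-1 * (p + vw) + (S / 2)^-1 * q) * S.
    by field; rewrite !gt_eqF.
  by rewrite ler_wpM2r// ltW.
lra.
Qed.

(** Multiplied by [2 * vm], the converse at [Q = vw], [D = vm] weighs the power by [2 * vm / vw],
    which [lam] dominates. *)
Lemma t_u_le_Jtot b lam ge gd : 0 < lam -> 2 * vm / vw <= lam ->
  policy ge -> policy gd -> ((t_u b vm)%:E <= Jtot m w b lam ge gd)%E.
Proof.
move=> lam0 hl pe pd; rewrite JtotE//.
have := channel_converse (b / 2) pe pd vw0 vm0 erefl.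
rewrite /t_u => conv.
apply: le_total_cost => //; [exact: power_ge0|exact: mse_ge0|move=> p q pE qE p0 q0].
move: conv; rewrite pE qE -!EFinM -!EFinD lee_fin => h.
have h1 : 2 * vm / vw * p <= lam * p by rewrite ler_wpM2r.
have : 2 * (2 * vm) <= 2 * vm / vw * p + 2 * vm + 2 * q.
  have -> : 2 * vm / vw * p + 2 * vm + 2 * q = (vw^-1 * (p + vw) + vm^-1 * q) * (2 * vm).
    by field; rewrite !gt_eqF.
  by rewrite ler_wpM2r// mulr_ge0// ltW.
lra.
Qed.

Lemma mutually_optimal_affine_foc b lam A C K L : 0 < lam ->
  mutually_optimal m w b lam (affine A C) (affine K L) ->
  [/\ A * (2 * K ^+ 2 + lam) = 2 * K, C = 0,
      K * (A ^+ 2 * vm + vw) = A * vm & K * C + L = - b / 2].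
Proof.
move=> lam0 [_ _ he hd].
have Kl : 0 < 2 * K ^+ 2 + lam by rewrite ltr_wpDl// mulr_ge0// sqr_ge0.
have Av : 0 < A ^+ 2 * vm + vw by rewrite ltr_wpDl// mulr_ge0 ?sqr_ge0// ltW.
have hL : K * C + L = - b / 2.
  have := hd _ (policy_affine K (- (K * C) - b / 2)).
  rewrite !Jtot_affine// lee_fin /jtot => h.
  have h2 : (K * C + L + b / 2) ^+ 2 <= 0 by lra.
  have : K * C + L + b / 2 = 0.
    by apply/eqP; rewrite -sqrf_eq0 -(rwP eqP); apply/le_anti; rewrite h2 sqr_ge0.
  lra.
have hC : (2 * K ^+ 2 + lam) * C = - (2 * K * (L + b / 2)).
  apply: quad_argmin => // C'.
  have := he _ (policy_affine A C'); rewrite !Jtot_affine// lee_fin /jtot; lra.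
split => //.
- have h : (2 * K ^+ 2 + lam) * vm * A = 2 * K * vm.
    apply: quad_argmin => [|A']; first exact: mulr_gt0.
    have := he _ (policy_affine A' C); rewrite !Jtot_affine// lee_fin /jtot; lra.
  by apply: (mulIf (lt0r_neq0 vm0)); rewrite -h; ring.
(* The decoder already cancels the bias [b / 2], so an offset of the signal would only cost
   power. *)
- apply: (mulfI (lt0r_neq0 lam0)); rewrite mulr0.
  have -> : lam * C = (2 * K ^+ 2 + lam) * C + 2 * K * (L + b / 2) -
     2 * K * (K * C + L + b / 2) by ring.
  by rewrite hC hL; field.
- rewrite mulrC; apply: quad_argmin => // K'.
  have := hd _ (policy_affine K' (L + K * C - K' * C)).
  rewrite !Jtot_affine// lee_fin /jtot; lra.
Qed.

(** As in the game, but the encoder weighs the error twice: [2 * vm * y ^+ 2 = lam * vw], and the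
    root in [t_i] is [2 * vm * y]. *)
Lemma mutually_optimal_affine_cost b lam A C K L : 0 < lam -> A != 0 ->
  A * (2 * K ^+ 2 + lam) = 2 * K -> C = 0 ->
  K * (A ^+ 2 * vm + vw) = A * vm -> K * C + L = - b / 2 ->
  jtot b lam A C K L = t_i b lam vm vw.
Proof.
move=> lam0 A0 hA -> hK hL.
pose y := 1 - K * A.
have KA : K * A = 1 - y by rewrite /y; ring.
have lA : lam * A ^+ 2 = 2 * (y * (1 - y)).
  have -> : lam * A ^+ 2 = A * (A * (2 * K ^+ 2 + lam)) - 2 * (K * A) ^+ 2 by ring.
  have e : A * (2 * K) = 2 * (K * A) by ring.
  by rewrite hA e KA; ring.
have vK : vw * K ^+ 2 = vm * (y * (1 - y)).
  have -> : vw * K ^+ 2 = K * (K * (A ^+ 2 * vm + vw)) - vm * (K * A) ^+ 2 by ring.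
  by rewrite hK mulrA KA; ring.
have A2 : 0 < A ^+ 2 by rewrite exprn_even_gt0.
have yy : 0 < y * (1 - y).
  have : 0 < lam * A ^+ 2 by rewrite mulr_gt0.
  by rewrite lA; lra.
have y0 : 0 < y by nra.
have y1 : y < 1 by nra.
have y2 : 2 * vm * y ^+ 2 = lam * vw.
  have z0 : (1 - y) ^+ 2 != 0 by rewrite sqrf_eq0 gt_eqF// subr_gt0.
  apply: (mulIf z0).
  have -> : 2 * vm * y ^+ 2 * (1 - y) ^+ 2 = vm * (y * (1 - y)) * (2 * (y * (1 - y))) by ring.
  by rewrite -vK -lA -KA; ring.
rewrite /t_i (@sqrt_uniq (2 * vm * y)); last 2 first.
- by rewrite mulr_ge0// ?mulr_ge0// ltW.
- have -> : (2 * vm * y) ^+ 2 = 2 * vm * (2 * vm * y ^+ 2) by ring.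
  by rewrite y2; ring.
have -> : jtot b lam A 0 K L =
    2 * (vm * y ^+ 2 + vw * K ^+ 2 + (K * 0 + L + b / 2) ^+ 2) + b ^+ 2 / 2 +
    vm * (lam * A ^+ 2).
  by rewrite /jtot /y; ring.
rewrite lA vK; have -> : K * 0 + L = - b / 2 by rewrite -hL.
by rewrite -y2; field.
Qed.

(** The first-order conditions are solved backwards through [y = 1 - K * A]; the threshold on [lam]
    is again [y < 1]. *)
Lemma t_i_attained b lam : 0 < lam -> lam < 2 * vm / vw ->
  exists A C K L, A != 0 /\ jtot b lam A C K L = t_i b lam vm vw.
Proof.
move=> lam0 hl.
have [vmn vwn lamn] : [/\ vm != 0, vw != 0 & lam != 0] by rewrite !gt_eqF.
pose y := Num.sqrt (lam * vw / (2 * vm)).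
have vm2 : 0 < 2 * vm by rewrite mulr_gt0.
have q0 : 0 < lam * vw / (2 * vm) by rewrite divr_gt0// mulr_gt0.
have y0 : 0 < y by rewrite sqrtr_gt0.
have y2 : y ^+ 2 = lam * vw / (2 * vm) by rewrite sqr_sqrtr// ltW.
have y1 : y < 1.
  by rewrite -(@expr_lt1 _ 2)// ?ltW// y2 ltr_pdivrMr// mul1r -ltr_pdivlMr.
pose A := Num.sqrt (2 * (y * (1 - y)) / lam).
have yy : 0 < 2 * (y * (1 - y)) by rewrite !mulr_gt0// subr_gt0.
have A2 : A ^+ 2 = 2 * (y * (1 - y)) / lam by rewrite sqr_sqrtr// divr_ge0// ltW.
have A0 : A != 0 by rewrite -sqrf_eq0 A2 gt_eqF// divr_gt0.
pose K := (1 - y) / A.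
have KA : K * A = 1 - y by rewrite divfK.
exists A, 0, K, (- b / 2); split => //; apply: mutually_optimal_affine_cost => //.
- apply: (mulIf A0).
  have -> : A * (2 * K ^+ 2 + lam) * A = 2 * (K * A) ^+ 2 + lam * A ^+ 2 by ring.
  have -> : 2 * K * A = 2 * (K * A) by ring.
  by rewrite KA A2; field.
- apply: (mulIf A0).
  have -> : K * (A ^+ 2 * vm + vw) * A = (K * A) * (A ^+ 2 * vm + vw) by ring.
  have -> : A * vm * A = A ^+ 2 * vm by ring.
  have -> : vw = y ^+ 2 * (2 * vm) / lam by rewrite y2; field; rewrite vmn lamn.
  by rewrite KA A2; field.
- by rewrite mulr0 add0r.
Qed.

Lemma informative_team_costsE b lam : 0 < lam -> lam < 2 * vm / vw ->
  informative_team_costs m w b lam = [set (t_i b lam vm vw)%:E].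
Proof.
move=> lam0 hl; apply/seteqP; split => [c [ge [gd [ho hi ->]]]|_ ->].
  have [A [C [K [L [A0 ? ?]]]]] := informative_affineP hi; subst ge gd.
  have [hA hC hK hL] := mutually_optimal_affine_foc lam0 ho.
  by rewrite Jtot_affine// (mutually_optimal_affine_cost lam0 A0 hA hC hK hL).
have [A [C [K [L [A0 hc]]]]] := t_i_attained b lam0 hl.
have pa A' C' := policy_affine A' C'.
exists (affine A C), (affine K L); split.
(* The pair attains the lower bound valid for all policies, so neither policy can be improved. *)
- split => // [ge pe|gd pd]; rewrite Jtot_affine// hc; exact: t_i_le_Jtot.
- exact: affine_informative.
- by rewrite Jtot_affine// hc.
Qed.

Lemma jtot_silent b lam : jtot b lam 0 0 0 (- b / 2) = t_u b vm.
Proof. by rewrite /jtot /t_u; field. Qed.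

(** Independence bounds the error by [vm] from below; silence with the constant action [- b / 2]
    attains this at zero power. *)
Lemma non_informative_team_costs_minimum b lam : 0 < lam ->
  is_minimum (non_informative_team_costs m w b lam) (t_u b vm)%:E.
Proof.
move=> lam0; split.
  exists (affine 0 0), (affine 0 (- b / 2)); split; try exact: policy_affine.
    by rewrite affine0; exact: independent_rv_cst.
  by rewrite Jtot_affine// jtot_silent.
move=> _ [ge [gd [pe pd hi ->]]]; rewrite JtotE//.
apply: le_total_cost => //; [exact: power_ge0|exact: mse_ge0|move=> p q _ qE p0 _].
have := mse_indep_ge (b / 2) pe pd hi; rewrite qE lee_fin /t_u => h.
have : 0 <= lam * p by rewrite mulr_ge0// ltW.
lra.
Qed.

(** The silent pair costs [t_u] and obeys the bound [t_i] valid for all policies. *)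
Lemma t_i_le_t_u b lam : 0 < lam -> t_i b lam vm vw <= t_u b vm.
Proof.
move=> lam0; have pa A C := policy_affine A C.
rewrite -(jtot_silent b lam) -lee_fin -Jtot_affine//; exact: t_i_le_Jtot.
Qed.

Lemma team_costs_minimum b lam : 0 < lam ->
  is_minimum (team_costs m w b lam)
    (if lam < 2 * vm / vw then Num.min (t_i b lam vm vw) (t_u b vm)
     else t_u b vm)%:E.
Proof.
move=> lam0; have pa A C := policy_affine A C; case: ifPn => hl.
  rewrite min_l ?t_i_le_t_u//; split.
    have [A [C [K [L [A0 hc]]]]] := t_i_attained b lam0 hl.
    exists (affine A C), (affine K L); split => //.
    by rewrite Jtot_affine// hc.
  by move=> _ [ge [gd [pe pd ->]]]; exact: t_i_le_Jtot.
split.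
  exists (affine 0 0), (affine 0 (- b / 2)); split => //.
  by rewrite Jtot_affine// jtot_silent.
move=> _ [ge [gd [pe pd ->]]]; apply: t_u_le_Jtot => //.
by rewrite leNgt.
Qed.

End Costs.

(* vm = E[m^2] and vw = E[w^2].  A set of costs being a singleton says both
   that a pair of the given kind exists and that all such pairs have that cost. *)
Theorem mainTheorem5 (d : measure_display) (T : measurableType d)
  (R : realType) (P : probability T R) (m w : {RV P >-> R})
  (b lam vm vw : R)
  (vm_gt0 : 0 < vm) (vw_gt0 : 0 < vw) (lam_gt0 : 0 < lam)
  (m_gauss : centered_gaussian m vm) (w_gauss : centered_gaussian w vw)
  (mw_indep : independent_rv P m w) :
  [/\ lam < vm / vw ->
        informative_game_costs m w b lam = [set (g_i b lam vm vw)%:E],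
      non_informative_game_costs m w b lam = [set (g_u b vm)%:E]
    & is_minimum (game_costs m w b lam)
        (if lam < vm / vw then Num.min (g_i b lam vm vw) (g_u b vm)
         else g_u b vm)%:E]
  /\
  [/\ lam < 2 * vm / vw ->
        informative_team_costs m w b lam = [set (t_i b lam vm vw)%:E],
      is_minimum (non_informative_team_costs m w b lam) (t_u b vm)%:E
    & is_minimum (team_costs m w b lam)
        (if lam < 2 * vm / vw then Num.min (t_i b lam vm vw) (t_u b vm)
         else t_u b vm)%:E].
Proof.
split; split.
- exact: informative_game_costsE.
- exact: (non_informative_game_costsE vm_gt0 vw_gt0).
- exact: game_costs_minimum.
- exact: informative_team_costsE.
- exact: (non_informative_team_costs_minimum vm_gt0 vw_gt0).
- exact: team_costs_minimum.
Qed.
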